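(* For every formula $A$ of propositional abstract separation logic and every label $w$: if the labelled sequent $\emptyset;\emptyset\vdash w:A$ is derivable in the calculus $LS_{PASL}$ (the cut rule being allowed), then $A$ is valid in all PASL Kripke relational models.
   Context: Formulae: $A ::= p \mid \top\mid\bot\mid\neg A\mid A\vee A\mid A\wedge A\mid A\to A\mid \top^*\mid A*A\mid A\mathrel{-\!\!*}A$, with $p$ ranging over a set $Var$ of propositional variables. Semantics. A PASL Kripke relational frame is a triple $(H,R,\epsilon)$ with $H$ a nonempty set, $R\subseteq H\times H\times H$, $\epsilon\in H$, such that for all $h_1,\dots,h_5\in H$: (identity) $R(h_1,\epsilon,h_2)\iff h_1=h_2$; (commutativity) $R(h_1,h_2,h_3)\iff R(h_2,h_1,h_3)$; (associativity) if $R(h_1,h_5,h_4)$ and $R(h_2,h_3,h_5)$ then there is $h_6$ with $R(h_6,h_3,h_4)$ and $R(h_1,h_2,h_6)$; (cancellativity) if $R(h_1,h_2,h_3)$ and $R(h_1,h_4,h_3)$ then $h_2=h_4$; (partial-determinism) if $R(h_1,h_2,h_3)$ and $R(h_1,h_2,h_4)$ then $h_3=h_4$. A model adds a valuation $\nu:Var\to\mathcal{P}(H)$. Forcing: $h\Vdash p$ iff $h\in\nu(p)$; $\top$ always holds, $\bot$ never; $\neg,\wedge,\vee,\to$ are interpreted classically at $h$; $h\Vdash\top^*$ iff $h=\epsilon$; $h\Vdash A*B$ iff there are $h_1,h_2$ with $R(h_1,h_2,h)$, $h_1\Vdash A$, $h_2\Vdash B$; $h\Vdash A\mathrel{-\!\!*}B$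 iff for all $h_1,h_2$, if $R(h,h_1,h_2)$ and $h_1\Vdash A$ then $h_2\Vdash B$. A formula is valid iff it is forced at every world of every such model. Calculus. Labels are elements of $LVar\cup\{\epsilon\}$, $LVar$ an infinite set of label variables, $\epsilon$ a label constant. A labelled formula is $a:A$; a relational atom is $(a,b\triangleright c)$ for labels $a,b,c$. A sequent $\mathcal{G};\Gamma\vdash\Delta$ consists of a set $\mathcal{G}$ of relational atoms and multisets $\Gamma,\Delta$ of labelled formulae; commas denote union. For a label variable $x$ and label $y$, $\mathcal{G}[y/x],\Gamma[y/x],\Delta[y/x]$ denote uniform replacement of $x$ by $y$. There are no rules for $\neg,\vee$: $\neg A$ abbreviates $A\to\bot$ and $A\vee B$ abbreviates $\neg A\to B$. Rules of $LS_{PASL}$ (premises $\Rightarrow$ conclusion; $p$ a propositional variable; ''fresh'' = a label variable not occurring in the conclusion): $id$: axiom $\mathcal{G};\Gamma,w:p\vdash w:p,\Delta$. $cut$: $\mathcal{G};\Gamma\vdash x:A,\Delta$ and $\mathcal{G}';\Gamma',x:A\vdash\Delta'$ $\Rightarrow$ $\mathcal{G},\mathcal{G}';\Gamma,\Gamma'\vdash\Delta,\Delta'$. $\bot L$: axiom $\mathcal{G};\Gamma,w:\bot\vdash\Delta$. $\top R$: axiom $\mathcal{G};\Gamma\vdash w:\top,\Delta$. $\top^*R$: axiom $\mathcal{G};\Gamma\vdash\epsilon:\top^*,\Delta$. $\top^*L$: $(\epsilon,w\triangleright\epsilon),\mathcal{G};\Gamma\vdash\Delta\Rightarrow\mathcal{G};\Gamma,w:\top^*\vdash\Delta$.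 $\wedge L$: $\mathcal{G};\Gamma,w:A,w:B\vdash\Delta\Rightarrow\mathcal{G};\Gamma,w:A\wedge B\vdash\Delta$. $\wedge R$: $\mathcal{G};\Gamma\vdash w:A,\Delta$ and $\mathcal{G};\Gamma\vdash w:B,\Delta\Rightarrow\mathcal{G};\Gamma\vdash w:A\wedge B,\Delta$. $\to L$: $\mathcal{G};\Gamma\vdash w:A,\Delta$ and $\mathcal{G};\Gamma,w:B\vdash\Delta\Rightarrow\mathcal{G};\Gamma,w:A\to B\vdash\Delta$. $\to R$: $\mathcal{G};\Gamma,w:A\vdash w:B,\Delta\Rightarrow\mathcal{G};\Gamma\vdash w:A\to B,\Delta$. $*L$: $(x,y\triangleright z),\mathcal{G};\Gamma,x:A,y:B\vdash\Delta\Rightarrow\mathcal{G};\Gamma,z:A*B\vdash\Delta$ ($x,y$ fresh). $\mathrel{-\!\!*}R$: $(x,z\triangleright y),\mathcal{G};\Gamma,x:A\vdash y:B,\Delta\Rightarrow\mathcal{G};\Gamma\vdash z:A\mathrel{-\!\!*}B,\Delta$ ($x,y$ fresh). $*R$: $(x,y\triangleright z),\mathcal{G};\Gamma\vdash x:A,z:A*B,\Delta$ and $(x,y\triangleright z),\mathcal{G};\Gamma\vdash y:B,z:A*B,\Delta\Rightarrow(x,y\triangleright z),\mathcal{G};\Gamma\vdash z:A*B,\Delta$. $\mathrel{-\!\!*}L$: $(x,y\triangleright z),\mathcal{G};\Gamma,y:A\mathrel{-\!\!*}B\vdash x:A,\Delta$ and $(x,y\triangleright z),\mathcal{G};\Gamma,y:A\mathrel{-\!\!*}B,z:B\vdash\Delta\Rightarrow(x,y\triangleright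 z),\mathcal{G};\Gamma,y:A\mathrel{-\!\!*}B\vdash\Delta$. $E$: $(y,x\triangleright z),(x,y\triangleright z),\mathcal{G};\Gamma\vdash\Delta\Rightarrow(x,y\triangleright z),\mathcal{G};\Gamma\vdash\Delta$. $A$: $(u,w\triangleright z),(y,v\triangleright w),(x,y\triangleright z),(u,v\triangleright x),\mathcal{G};\Gamma\vdash\Delta\Rightarrow(x,y\triangleright z),(u,v\triangleright x),\mathcal{G};\Gamma\vdash\Delta$ ($w$ fresh). $U$: $(x,\epsilon\triangleright x),\mathcal{G};\Gamma\vdash\Delta\Rightarrow\mathcal{G};\Gamma\vdash\Delta$. $A_C$: $(x,w\triangleright x),(y,y\triangleright w),(x,y\triangleright x),\mathcal{G};\Gamma\vdash\Delta\Rightarrow(x,y\triangleright x),\mathcal{G};\Gamma\vdash\Delta$ ($w$ fresh). $Eq_1$: $(\epsilon,w'\triangleright w'),\mathcal{G}[w'/w];\Gamma[w'/w]\vdash\Delta[w'/w]\Rightarrow(\epsilon,w\triangleright w'),\mathcal{G};\Gamma\vdash\Delta$. $Eq_2$: same premise $\Rightarrow(\epsilon,w'\triangleright w),\mathcal{G};\Gamma\vdash\Delta$. $P$: $(x,y\triangleright z),\mathcal{G}[z/w];\Gamma[z/w]\vdash\Delta[z/w]\Rightarrow(x,y\triangleright z),(x,y\triangleright w),\mathcal{G};\Gamma\vdash\Delta$. $C$: $(x,y\triangleright z),\mathcal{G}[y/w];\Gamma[y/w]\vdash\Delta[y/w]\Rightarrow(x,y\triangleright z),(x,w\triangleright z),\mathcal{G};\Gamma\vdash\Delta$.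 In $Eq_1,Eq_2,P,C$ the label $w$ substituted for must be a label variable (never $\epsilon$).
   Formalization: The label w ranges over label variables only, not the constant ε: for w = ε the claim fails, since ε:⊤* is an axiom of the calculus but ⊤* is not valid. *)

(* Defs.v *)
From HB Require Import structures.
From mathcomp Require Import all_boot.
From mathcomp Require Export finmap multiset.

Set Implicit Arguments.
Unset Strict Implicit.
Unset Printing Implicit Defensive.

Inductive formula (Var : Type) : Type :=
  | Fvar of Var
  | Ftop
  | Fbot
  | Fneg of formula Var
  | For of formula Var & formula Var
  | Fand of formula Var & formula Var
  | Fimp of formula Var & formula Var
  | Femp (* the multiplicative unit, top-star *)
  | Fstar of formula Var & formula Var
  | Fwand of formula Var & formula Var.

Arguments Ftop {Var}.
Arguments Fbot {Var}.
Arguments Femp {Var}.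

(* An encoding of formulae into generic trees; it only serves to make
   [formula Var] a choiceType, as finite multisets of formulae require. *)
Section FormulaChoice.
Variable Var : choiceType.

Fixpoint formula_encode (A : formula Var) : GenTree.tree Var :=
  match A with
  | Fvar p => GenTree.Leaf p
  | Ftop => GenTree.Node 0 [::]
  | Fbot => GenTree.Node 1 [::]
  | Fneg A => GenTree.Node 2 [:: formula_encode A]
  | For A B => GenTree.Node 3 [:: formula_encode A; formula_encode B]
  | Fand A B => GenTree.Node 4 [:: formula_encode A; formula_encode B]
  | Fimp A B => GenTree.Node 5 [:: formula_encode A; formula_encode B]
  | Femp => GenTree.Node 6 [::]
  | Fstar A B => GenTree.Node 7 [:: formula_encode A; formula_encode B]
  | Fwand A B => GenTree.Node 8 [:: formula_encode A; formula_encode B]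
  end.

Fixpoint formula_decode (t : GenTree.tree Var) : formula Var :=
  match t with
  | GenTree.Leaf p => Fvar p
  | GenTree.Node 1 _ => Fbot
  | GenTree.Node 2 [:: a] => Fneg (formula_decode a)
  | GenTree.Node 3 [:: a; b] => For (formula_decode a) (formula_decode b)
  | GenTree.Node 4 [:: a; b] => Fand (formula_decode a) (formula_decode b)
  | GenTree.Node 5 [:: a; b] => Fimp (formula_decode a) (formula_decode b)
  | GenTree.Node 6 _ => Femp
  | GenTree.Node 7 [:: a; b] => Fstar (formula_decode a) (formula_decode b)
  | GenTree.Node 8 [:: a; b] => Fwand (formula_decode a) (formula_decode b)
  | GenTree.Node _ _ => Ftop
  end.

Lemma formula_encodeK : cancel formula_encode formula_decode.
Proof. by elim=> //= [A ->|A -> B ->|A -> B ->|A -> B ->|A -> B ->|A -> B ->]. Qed.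

HB.instance Definition _ :=
  Choice.copy (formula Var) (can_type formula_encodeK).

End FormulaChoice.

Record pasl_frame : Type := PaslFrame {
  world :> Type;
  rel3 : world -> world -> world -> Prop;
  unit_world : world;
  pasl_identity : forall h1 h2, rel3 h1 unit_world h2 <-> h1 = h2;
  pasl_commutativity : forall h1 h2 h3, rel3 h1 h2 h3 <-> rel3 h2 h1 h3;
  pasl_associativity : forall h1 h2 h3 h4 h5,
    rel3 h1 h5 h4 -> rel3 h2 h3 h5 ->
    exists h6, rel3 h6 h3 h4 /\ rel3 h1 h2 h6;
  pasl_cancellativity : forall h1 h2 h3 h4,
    rel3 h1 h2 h3 -> rel3 h1 h4 h3 -> h2 = h4;
  pasl_partial_determinism : forall h1 h2 h3 h4,
    rel3 h1 h2 h3 -> rel3 h1 h2 h4 -> h3 = h4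
}.

Record pasl_model (Var : Type) : Type := PaslModel {
  frame :> pasl_frame;
  valuation : Var -> frame -> Prop
}.

Fixpoint forces (Var : Type) (M : pasl_model Var) (h : M) (A : formula Var)
    : Prop :=
  match A with
  | Fvar p => valuation p h
  | Ftop => True
  | Fbot => False
  | Fneg A => ~ forces h A
  | For A B => forces h A \/ forces h B
  | Fand A B => forces h A /\ forces h B
  | Fimp A B => forces h A -> forces h B
  | Femp => h = unit_world M
  | Fstar A B => exists h1 h2 : M,
      [/\ rel3 h1 h2 h, forces h1 A & forces h2 B]
  | Fwand A B => forall h1 h2 : M,
      rel3 h h1 h2 -> forces h1 A -> forces h2 B
  end.

Definition valid (Var : Type) (A : formula Var) : Prop :=
  forall (M : pasl_model Var) (h : M), forces h A.

(* The calculus has no rules for [Fneg] and [For]: there, negation and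
   disjunction abbreviate the formulae they are unfolded to here. *)
Fixpoint unabbrev (Var : Type) (A : formula Var) : formula Var :=
  match A with
  | Fvar p => Fvar p
  | Ftop => Ftop
  | Fbot => Fbot
  | Fneg A => Fimp (unabbrev A) Fbot
  | For A B => Fimp (Fimp (unabbrev A) Fbot) (unabbrev B)
  | Fand A B => Fand (unabbrev A) (unabbrev B)
  | Fimp A B => Fimp (unabbrev A) (unabbrev B)
  | Femp => Femp
  | Fstar A B => Fstar (unabbrev A) (unabbrev B)
  | Fwand A B => Fwand (unabbrev A) (unabbrev B)
  end.

(* Soundness concerns end-sequents labelled by a label variable [Lvar w]: since
   [Leps] denotes the unit world, [Femp] is derivable at [Leps] by [LS_empR]
   although it is not a valid formula. *)
Inductive label (LVar : Type) : Type :=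
  | Lvar of LVar
  | Leps.

Arguments Leps {LVar}.

Section LabelChoice.
Variable LVar : choiceType.

Definition label_encode (l : label LVar) : option LVar :=
  if l is Lvar x then Some x else None.

Definition label_decode (o : option LVar) : label LVar :=
  if o is Some x then Lvar x else Leps.

Lemma label_encodeK : cancel label_encode label_decode.
Proof. by case. Qed.

HB.instance Definition _ :=
  Choice.copy (label LVar) (can_type label_encodeK).

End LabelChoice.

(* The triple (a, b, c) stands for the relational atom (a, b |> c). *)
Notation rel_atom LVar := (label LVar * label LVar * label LVar)%type.
Notation lformula Var LVar := (label LVar * formula Var)%type.

Local Open Scope mset_scope.
Local Open Scope fset_scope.

Section Calculus.
Variables Var LVar : choiceType.

Implicit Types (x y z w : LVar) (a b c d l : label LVar).
Implicit Types (A B : formula Var) (p : Var).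
Implicit Types (G : {fset rel_atom LVar}) (Ga De : {mset lformula Var LVar}).

Definition subst_label x b a : label LVar := if a == Lvar x then b else a.

Definition subst_atom x b (r : rel_atom LVar) : rel_atom LVar :=
  (subst_label x b r.1.1, subst_label x b r.1.2, subst_label x b r.2).

Definition subst_lformula x b (f : lformula Var LVar) : lformula Var LVar :=
  (subst_label x b f.1, f.2).

Definition subst_rel x b G : {fset rel_atom LVar} :=
  [fset subst_atom x b r | r in G].

(* [map] acts on the enumeration of the multiset, so multiplicities are kept. *)
Definition subst_mset x b Ga : {mset lformula Var LVar} :=
  seq_mset (map (subst_lformula x b) Ga).

Definition fresh x G Ga De : Prop :=
  [/\ forall r, r \in G ->
        [/\ r.1.1 != Lvar x, r.1.2 != Lvar x & r.2 != Lvar x],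
      forall f, f \in Ga -> f.1 != Lvar x
    & forall f, f \in De -> f.1 != Lvar x].

Local Notation "G [ x := b ]r" := (subst_rel x b G)
  (at level 2, left associativity, format "G [ x  :=  b ]r").
Local Notation "Ga [ x := b ]m" := (subst_mset x b Ga)
  (at level 2, left associativity, format "Ga [ x  :=  b ]m").

(* [G ;; Ga |- De] is derivability of the sequent. Since [G] is a set, it may
   itself contain an atom that is displayed next to it. The two fresh variables
   of [LS_starL], and of [LS_wandR], must be distinct: without [x != y] these
   rules are unsound. A label variable substituted for ([w] in [LS_Eq1],
   [LS_Eq2], [LS_P], [LS_C]) has type [LVar], so it is never [Leps]; the label
   replacing it is arbitrary. *)
Reserved Notation "G ;; Ga |- De" (at level 70, Ga at next level, no associativity).

Inductive LS_PASL :
    {fset rel_atom LVar} -> {mset lformula Var LVar} ->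
    {mset lformula Var LVar} -> Prop :=
  | LS_id G Ga De a p :
      G ;; (a, Fvar p) +` Ga |- (a, Fvar p) +` De
  | LS_cut G G' Ga Ga' De De' a A :
      G ;; Ga |- (a, A) +` De ->
      G' ;; (a, A) +` Ga' |- De' ->
      G `|` G' ;; Ga `+` Ga' |- De `+` De'
  | LS_botL G Ga De a :
      G ;; (a, Fbot) +` Ga |- De
  | LS_topR G Ga De a :
      G ;; Ga |- (a, Ftop) +` De
  | LS_empR G Ga De :
      G ;; Ga |- (Leps, Femp) +` De
  | LS_empL G Ga De a :
      (Leps, a, Leps) |` G ;; Ga |- De ->
      G ;; (a, Femp) +` Ga |- De
  | LS_andL G Ga De a A B :
      G ;; (a, A) +` ((a, B) +` Ga) |- De ->
      G ;; (a, Fand A B) +` Ga |- De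
  | LS_andR G Ga De a A B :
      G ;; Ga |- (a, A) +` De ->
      G ;; Ga |- (a, B) +` De ->
      G ;; Ga |- (a, Fand A B) +` De
  | LS_impL G Ga De a A B :
      G ;; Ga |- (a, A) +` De ->
      G ;; (a, B) +` Ga |- De ->
      G ;; (a, Fimp A B) +` Ga |- De
  | LS_impR G Ga De a A B :
      G ;; (a, A) +` Ga |- (a, B) +` De ->
      G ;; Ga |- (a, Fimp A B) +` De
  | LS_starL G Ga De x y c A B :
      x != y ->
      fresh x G ((c, Fstar A B) +` Ga) De ->
      fresh y G ((c, Fstar A B) +` Ga) De ->
      (Lvar x, Lvar y, c) |` G ;; (Lvar x, A) +` ((Lvar y, B) +` Ga) |- De ->
      G ;; (c, Fstar A B) +` Ga |- De
  | LS_wandR G Ga De x y c A B :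
      x != y ->
      fresh x G Ga ((c, Fwand A B) +` De) ->
      fresh y G Ga ((c, Fwand A B) +` De) ->
      (Lvar x, c, Lvar y) |` G ;; (Lvar x, A) +` Ga |- (Lvar y, B) +` De ->
      G ;; Ga |- (c, Fwand A B) +` De
  | LS_starR G Ga De a b c A B :
      (a, b, c) |` G ;; Ga |- (a, A) +` ((c, Fstar A B) +` De) ->
      (a, b, c) |` G ;; Ga |- (b, B) +` ((c, Fstar A B) +` De) ->
      (a, b, c) |` G ;; Ga |- (c, Fstar A B) +` De
  | LS_wandL G Ga De a b c A B :
      (a, b, c) |` G ;; (b, Fwand A B) +` Ga |- (a, A) +` De ->
      (a, b, c) |` G ;; (b, Fwand A B) +` ((c, B) +` Ga) |- De ->
      (a, b, c) |` G ;; (b, Fwand A B) +` Ga |- De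
  | LS_E G Ga De a b c :
      (b, a, c) |` ((a, b, c) |` G) ;; Ga |- De ->
      (a, b, c) |` G ;; Ga |- De
  | LS_A G Ga De a b c d l w :
      fresh w ((a, b, c) |` ((d, l, a) |` G)) Ga De ->
      (d, Lvar w, c) |` ((b, l, Lvar w) |` ((a, b, c) |` ((d, l, a) |` G)))
        ;; Ga |- De ->
      (a, b, c) |` ((d, l, a) |` G) ;; Ga |- De
  | LS_U G Ga De a :
      (a, Leps, a) |` G ;; Ga |- De ->
      G ;; Ga |- De
  | LS_AC G Ga De a b w :
      fresh w ((a, b, a) |` G) Ga De ->
      (a, Lvar w, a) |` ((b, b, Lvar w) |` ((a, b, a) |` G)) ;; Ga |- De ->
      (a, b, a) |` G ;; Ga |- De
  | LS_Eq1 G Ga De w b :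
      (Leps, b, b) |` G[w := b]r ;; Ga[w := b]m |- De[w := b]m ->
      (Leps, Lvar w, b) |` G ;; Ga |- De
  | LS_Eq2 G Ga De w b :
      (Leps, b, b) |` G[w := b]r ;; Ga[w := b]m |- De[w := b]m ->
      (Leps, b, Lvar w) |` G ;; Ga |- De
  | LS_P G Ga De a b c w :
      (a, b, c) |` G[w := c]r ;; Ga[w := c]m |- De[w := c]m ->
      (a, b, c) |` ((a, b, Lvar w) |` G) ;; Ga |- De
  | LS_C G Ga De a b c w :
      (a, b, c) |` G[w := b]r ;; Ga[w := b]m |- De[w := b]m ->
      (a, b, c) |` ((a, Lvar w, c) |` G) ;; Ga |- De
where "G ;; Ga |- De" := (LS_PASL G Ga De).

End Calculus.

(* Main.v *)
(** Read a sequent as the claim that it has no countermodel: no assignment of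
    worlds to labels satisfies every relational atom and every antecedent
    formula while falsifying every succedent formula.  Each rule preserves this
    claim.  For the substitution rules [Eq1], [Eq2], [P], [C] the frame axioms
    force the two identified labels to denote the same world, so the assignment
    is unaffected by the substitution and can be reused for the premise. *)
Require Import Defs.
From mathcomp Require Import all_boot.
From Stdlib Require Import Classical.

Set Implicit Arguments.
Unset Strict Implicit.
Unset Printing Implicit Defensive.

Local Open Scope mset_scope.
Local Open Scope fset_scope.

(** * Consequences of the frame axioms *)

Section Frame.
Variable F : pasl_frame.
Implicit Types a b c d : F.

Lemma rel3C a b c : rel3 a b c -> rel3 b a c.
Proof. by move/pasl_commutativity. Qed.

Lemma rel3_unitr a : rel3 a (unit_world F) a.
Proof. exact/pasl_identity. Qed.

Lemma rel3_unitl_eq a b : rel3 (unit_world F) a b -> a = b.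
Proof. by move/rel3C/pasl_identity. Qed.

(** Associativity with both atoms turned round by commutativity. It supplies the world for the fresh
    label of rule $A$ and, when the two atoms coincide, of $A_C$. *)
Lemma rel3_shift a b c d l : rel3 a b c -> rel3 d l a ->
  exists w, rel3 d w c /\ rel3 b l w.
Proof.
move=> /rel3C abc /rel3C dla.
have [w [wdc blw]] := pasl_associativity abc dla.
by exists w; split=> //; apply: rel3C.
Qed.

End Frame.

(** Only disjunction needs excluded middle: $\neg A\to B$ yields $A\vee B$ by cases on whether $A$
    is forced at [h]. *)
Lemma forces_unabbrev (Var : Type) (M : pasl_model Var) (A : formula Var)
  (h : M) : forces h (unabbrev A) <-> forces h A.
Proof.
elim: A h => //= [A IHA|A IHA B IHB|A IHA B IHB|A IHA B IHB|A IHA B IHB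
  |A IHA B IHB] h.
- by rewrite IHA.
- by rewrite IHA IHB; split; [case: (classic (forces h A)); tauto | tauto].
- by rewrite IHA IHB.
- by rewrite IHA IHB.
- by split=> -[h1 [h2 [? /IHA ? /IHB ?]]]; exists h1, h2.
- by split=> AB h1 h2 /AB {}AB /IHA /AB /IHB.
Qed.

(** * Truth of sequents in a fixed model *)

Section Soundness.
Variables (Var LVar : choiceType) (M : pasl_model Var).
Implicit Types (rho : LVar -> M) (a b : label LVar) (x : LVar).
Implicit Types (r : rel_atom LVar) (f : lformula Var LVar).
Implicit Types (G : {fset rel_atom LVar}) (Ga De : {mset lformula Var LVar}).

Definition label_world rho a : M :=
  if a is Lvar x then rho x else unit_world M.

Definition atom_holds rho r : Prop :=
  rel3 (label_world rho r.1.1) (label_world rho r.1.2) (label_world rho r.2).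

Definition formula_holds rho f : Prop := forces (label_world rho f.1) f.2.

Definition atoms_hold rho G : Prop := forall r, r \in G -> atom_holds rho r.

Definition all_hold rho Ga : Prop := forall f, f \in Ga -> formula_holds rho f.

Definition all_fail rho De : Prop :=
  forall f, f \in De -> ~ formula_holds rho f.

Lemma atoms_hold1U rho r G :
  atoms_hold rho (r |` G) <-> atom_holds rho r /\ atoms_hold rho G.
Proof.
split=> [rG|[? rG] r' /fset1UP[->|/rG] //].
by split=> [|r' r'G]; apply: rG; rewrite ?fset1U1 ?fset1Ur.
Qed.

Lemma all_hold1D rho f Ga :
  all_hold rho (f +` Ga) <-> formula_holds rho f /\ all_hold rho Ga.
Proof.
split=> [fGa|[? fGa] f'].
  by split=> [|f' f'Ga]; apply: fGa; rewrite ?mset1D1 ?mset1Dr.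
by rewrite in_mset1D => /predU1P[->|/fGa].
Qed.

Lemma all_fail1D rho f De :
  all_fail rho (f +` De) <-> ~ formula_holds rho f /\ all_fail rho De.
Proof.
split=> [fDe|[? fDe] f'].
  by split=> [|f' f'De]; apply: fDe; rewrite ?mset1D1 ?mset1Dr.
by rewrite in_mset1D => /predU1P[->|/fDe].
Qed.

Definition holdsE := (atoms_hold1U, all_hold1D, all_fail1D).

Definition update rho x (h : M) : LVar -> M :=
  fun y => if y == x then h else rho y.

Lemma update_same rho x h : update rho x h x = h.
Proof. by rewrite /update eqxx. Qed.

Lemma label_world_update rho x h a :
  a != Lvar x -> label_world (update rho x h) a = label_world rho a.
Proof.
by case: a => //= y; rewrite /update; case: (eqVneq y x) => // ->; rewrite eqxx.
Qed.

(** Distinctness keeps the second update from overwriting [h1]; this is where the side condition of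
    $*L$ and $-\!\!*R$ is used. *)
Lemma label_world_update2 rho x y h1 h2 : x != y ->
  label_world (update (update rho x h1) y h2) (Lvar x) = h1 /\
  label_world (update (update rho x h1) y h2) (Lvar y) = h2.
Proof. by move=> xy; rewrite /= /update !eqxx (negbTE xy). Qed.

(** An assignment refuting a sequent still refutes it after any change at a variable that does not
    occur there. *)
Lemma fresh_update rho x h G Ga De : fresh x G Ga De ->
  [/\ atoms_hold rho G -> atoms_hold (update rho x h) G,
      all_hold rho Ga -> all_hold (update rho x h) Ga
    & all_fail rho De -> all_fail (update rho x h) De].
Proof.
case=> xG xGa xDe; split=> H f fin; have := H f fin.
- by have [? ? ?] := xG f fin; rewrite /atom_holds !label_world_update.
- by rewrite /formula_holds label_world_update ?xGa.
- by rewrite /formula_holds label_world_update ?xDe.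
Qed.

Lemma label_world_subst rho x b a : rho x = label_world rho b ->
  label_world rho (subst_label x b a) = label_world rho a.
Proof. by rewrite /subst_label; case: eqP => // ->. Qed.

(** Truth of a multiset depends on membership alone, so multiplicities can be forgotten. *)
Lemma subst_mset_in x b Ga f : f \in subst_mset x b Ga ->
  exists2 f', f' \in Ga & f = subst_lformula x b f'.
Proof. by rewrite in_mset mset_seqE -has_count has_pred1 => /mapP. Qed.

Lemma atoms_hold_subst rho x b G : rho x = label_world rho b ->
  atoms_hold rho G -> atoms_hold rho (subst_rel x b G).
Proof.
move=> xb GH r /imfsetP[r' /= /GH H ->].
by rewrite /atom_holds /= !label_world_subst.
Qed.

Lemma all_hold_subst rho x b Ga : rho x = label_world rho b ->
  all_hold rho Ga -> all_hold rho (subst_mset x b Ga).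
Proof.
move=> xb GaH f /subst_mset_in[f' /GaH H ->].
by rewrite /formula_holds /= label_world_subst.
Qed.

Lemma all_fail_subst rho x b De : rho x = label_world rho b ->
  all_fail rho De -> all_fail rho (subst_mset x b De).
Proof.
move=> xb DeH f /subst_mset_in[f' /DeH H ->].
by rewrite /formula_holds /= label_world_subst.
Qed.

(** With this negative form no formula on the right has to be selected; the rule cases appeal to
    classical logic only for $\to R$ and $-\!\!*R$. *)
Definition irrefutable G Ga De : Prop :=
  forall rho, atoms_hold rho G -> all_hold rho Ga -> all_fail rho De -> False.

(** The common core of the four substitution rules; [r] is the atom that their premise displays
    outside the substitution. *)
Lemma irrefutable_subst rho x b r G Ga De : rho x = label_world rho b ->
  irrefutable (r |` subst_rel x b G) (subst_mset x b Ga) (subst_mset x b De) ->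
  atom_holds rho r -> atoms_hold rho G -> all_hold rho Ga -> all_fail rho De ->
  False.
Proof.
move=> xb irr rH GH GaH DeH; apply: (irr rho).
- by rewrite holdsE; split=> //; apply: atoms_hold_subst.
- exact: all_hold_subst.
- exact: all_fail_subst.
Qed.

Theorem LS_PASL_irrefutable G Ga De : LS_PASL G Ga De -> irrefutable G Ga De.
Proof.
elim=> {G Ga De}.
- by move=> G Ga De a p rho _; rewrite !holdsE => -[? _] [].
- move=> G G' Ga Ga' De De' a A _ IH1 _ IH2 rho GH GaH DeH.
  (* By the second premise the cut formula cannot hold, and its failure makes [rho] refute the
     first. *)
  have failA : ~ formula_holds rho (a, A).
    move=> aA; apply: (IH2 rho) => [r rin||f fin].
    + by apply: GH; rewrite in_fsetU rin orbT.
    + by rewrite holdsE; split=> // f fin; apply: GaH; rewrite in_msetD fin orbT.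
    + by apply: DeH; rewrite in_msetD fin orbT.
  apply: (IH1 rho) => [r rin|f fin|].
  + by apply: GH; rewrite in_fsetU rin.
  + by apply: GaH; rewrite in_msetD fin.
  + by rewrite holdsE; split=> // f fin; apply: DeH; rewrite in_msetD fin.
- by move=> G Ga De a rho _; rewrite holdsE => -[].
- by move=> G Ga De a rho _ _; rewrite holdsE => -[/(_ I)].
- by move=> G Ga De rho _ _; rewrite holdsE => -[/(_ erefl)].
- move=> G Ga De a _ IH rho GH; rewrite holdsE => -[aE GaH].
  apply: IH => //; rewrite holdsE; split=> //.
  (* As [a] denotes the unit, the new atom reads $R(\epsilon,\epsilon,\epsilon)$. *)
  by rewrite /atom_holds /= [label_world rho a]aE; apply: rel3_unitr.
- move=> G Ga De a A B _ IH rho GH; rewrite holdsE => -[[aA aB] GaH].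
  by apply: IH => //; rewrite !holdsE.
- move=> G Ga De a A B _ IH1 _ IH2 rho GH GaH; rewrite holdsE => -[aAB DeH].
  (* For [rho] to refute the first premise, only the failure of [A] is missing. If [A] holds, the
     second premise is treated likewise. The other branching rules follow this pattern. *)
  apply: (IH1 rho) => //; rewrite holdsE; split=> // aA.
  by apply: (IH2 rho) => //; rewrite holdsE; split=> // aB; apply: aAB.
- move=> G Ga De a A B _ IH1 _ IH2 rho GH; rewrite holdsE => -[aAB GaH] DeH.
  apply: (IH1 rho) => //; rewrite holdsE; split=> // aA.
  by apply: (IH2 rho) => //; rewrite holdsE; split=> //; apply: aAB.
- move=> G Ga De a A B _ IH rho GH GaH.
  rewrite holdsE => -[aAB DeH]; apply: aAB => aA; apply: NNPP => aB.
  by apply: (IH rho) => //; rewrite holdsE.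
- move=> G Ga De x y c A B xy xfr yfr _ IH rho GH GaH DeH.
  have /all_hold1D[[h1 [h2 [/= R12 hA hB]]] _] := GaH.
  have [GH1 GaH1 DeH1] := fresh_update rho h1 xfr.
  have [GH2 GaH2 DeH2] := fresh_update (update rho x h1) h2 yfr.
  have /GaH2/all_hold1D[_ GaH'] := GaH1 GaH.
  (* Freshness covers the principal formula, so [c] keeps its world under both updates. *)
  have [_ /(_ _ (mset1D1 _ _)) /= xc _] := xfr.
  have [_ /(_ _ (mset1D1 _ _)) /= yc _] := yfr.
  have [xw yw] := label_world_update2 rho h1 h2 xy.
  apply: (IH (update (update rho x h1) y h2)); rewrite ?holdsE.
  + split; last exact: GH2 (GH1 GH).
    by rewrite /atom_holds [_.1.1]/= [_.1.2]/= [_.2]/= xw yw !label_world_update.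
  + by rewrite /formula_holds [_.1]/= xw [(Lvar y, B).1]/= yw.
  + exact: DeH2 (DeH1 DeH).
- move=> G Ga De x y c A B xy xfr yfr _ IH rho GH GaH DeH.
  have /all_fail1D[cAB _] := DeH.
  (* The failing wand provides the worlds for [x] and [y]: [h1] forces [A], while [h2] does not
     force [B]. *)
  apply: cAB => /= h1 h2 R12 hA; apply: NNPP => hB.
  have [GH1 GaH1 DeH1] := fresh_update rho h1 xfr.
  have [GH2 GaH2 DeH2] := fresh_update (update rho x h1) h2 yfr.
  have /DeH2/all_fail1D[_ DeH'] := DeH1 DeH.
  have [_ _ /(_ _ (mset1D1 _ _)) /= xc] := xfr.
  have [_ _ /(_ _ (mset1D1 _ _)) /= yc] := yfr.
  have [xw yw] := label_world_update2 rho h1 h2 xy.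
  apply: (IH (update (update rho x h1) y h2)); rewrite ?holdsE.
  + split; last exact: GH2 (GH1 GH).
    rewrite /atom_holds [_.1.1]/= [_.1.2]/= [_.2]/= xw yw !label_world_update //.
    exact: rel3C.
  + by split; [rewrite /formula_holds [_.1]/= xw | apply: GaH2 (GaH1 GaH)].
  + by rewrite /formula_holds [_.1]/= yw.
- move=> G Ga De a b c A B _ IH1 _ IH2 rho GH GaH DeH.
  have /atoms_hold1U[Rabc _] := GH; have /all_fail1D[cAB _] := DeH.
  apply: (IH1 rho) => //; rewrite all_fail1D; split=> // aA.
  apply: (IH2 rho) => //; rewrite all_fail1D; split=> // bB.
  by apply: cAB; exists (label_world rho a), (label_world rho b).
- move=> G Ga De a b c A B _ IH1 _ IH2 rho GH GaH DeH.
  have /atoms_hold1U[Rabc _] := GH; have /all_hold1D[bAB GaH'] := GaH.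
  apply: (IH1 rho) => //; rewrite all_fail1D; split=> // aA.
  apply: (IH2 rho) => //; rewrite !holdsE; split=> //; split=> //.
  by apply: bAB aA; apply: rel3C.
- move=> G Ga De a b c _ IH rho GH; apply: IH; rewrite atoms_hold1U.
  by split=> //; apply: rel3C; have /atoms_hold1U[] := GH.
- move=> G Ga De a b c d l w wfr _ IH rho GH GaH DeH.
  have := GH; rewrite !holdsE => -[Rabc [Rdla _]].
  have [h [Rdhc Rblh]] := rel3_shift Rabc Rdla.
  have [/(_ GH) GHw /(_ GaH) GaHw /(_ DeH) DeHw] := fresh_update rho h wfr.
  have [wG _ _] := wfr; have [/= _ wb wc] := wG _ (fset1U1 _ _).
  have [/= wd wl _] := wG _ (fset1Ur _ (fset1U1 (d, l, a) G)).
  apply: (IH (update rho w h)) => //.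
  rewrite atoms_hold1U (atoms_hold1U _ (b, l, _)) /atom_holds /=.
  by rewrite update_same !label_world_update.
- by move=> G Ga De a _ IH rho GH; apply: IH; rewrite holdsE; split=> //;
    apply: rel3_unitr.
- move=> G Ga De a b w wfr _ IH rho GH GaH DeH.
  have /atoms_hold1U[Raba _] := GH.
  (* Using $R(a,b,a)$ as both atoms gives $R(a,h,a)$ and $R(b,b,h)$. *)
  have [h [Raha Rbbh]] := rel3_shift Raba Raba.
  have [/(_ GH) GHw /(_ GaH) GaHw /(_ DeH) DeHw] := fresh_update rho h wfr.
  have [/(_ (a, b, a) (fset1U1 _ _)) /= [wa wb _] _ _] := wfr.
  apply: (IH (update rho w h)) => //.
  rewrite atoms_hold1U (atoms_hold1U _ (b, b, _)) /atom_holds /=.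
  by rewrite update_same !label_world_update.
- move=> G Ga De w b _ IH rho; rewrite holdsE => -[/rel3_unitl_eq wb GH].
  (* The displayed atom $(\epsilon,b\triangleright b)$ of the premise is true under every
     assignment, by the unit law. *)
  by apply: (irrefutable_subst wb IH _ GH); apply/rel3C/rel3_unitr.
- move=> G Ga De w b _ IH rho; rewrite holdsE => -[/rel3_unitl_eq /esym wb GH].
  by apply: (irrefutable_subst wb IH _ GH); apply/rel3C/rel3_unitr.
- move=> G Ga De a b c w _ IH rho; rewrite !holdsE => -[Rabc [Rabw GH]].
  apply: (irrefutable_subst _ IH Rabc GH).
  exact: pasl_partial_determinism Rabw Rabc.
- move=> G Ga De a b c w _ IH rho; rewrite !holdsE => -[Rabc [Rawc GH]].
  apply: (irrefutable_subst _ IH Rabc GH).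
  exact: pasl_cancellativity Rawc Rabc.
Qed.

End Soundness.

Theorem mainTheorem1 (Var LVar : choiceType)
    (LVar_infinite : forall s : seq LVar, exists x : LVar, x \notin s)
    (A : formula Var) (w : LVar) :
  LS_PASL fset0 mset0 [mset (Lvar w, unabbrev A)] -> valid A.
Proof.
move=> derivA M h; apply/forces_unabbrev; apply: NNPP => failA.
(* The label variable [w] must denote [h]. The sequent has no other label, so a constant assignment
   suffices. *)
apply: (LS_PASL_irrefutable derivA (rho := fun=> h)) => [r|f|f].
- by rewrite in_fset0.
- by rewrite in_mset0.
- by rewrite in_mset1 => /eqP ->.
Qed.
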